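(* Let $n \geq 2$ be an integer, let $A$ and $B$ be $C^*$-algebras (not assumed unital), and let $\phi : A \to B$ be an involutive $n$-homomorphism. If $n$ is even, then $\phi$ is a $*$-homomorphism. If $n \geq 3$ is odd, then there exist two orthogonal $*$-homomorphisms $\psi_1, \psi_2 : A \to B$ such that $\phi(a) = \psi_1(a) - \psi_2(a)$ for all $a \in A$.
   Context: An $n$-homomorphism between algebras $A$ and $B$ is a linear map $\phi : A \to B$ with $\phi(a_1 a_2 \cdots a_n) = \phi(a_1)\phi(a_2)\cdots\phi(a_n)$ for all $a_1,\dots,a_n \in A$. It is involutive if $\phi(a^* ) = \phi(a)^*$ for all $a \in A$. No continuity of $\phi$ is assumed. Two linear maps $\psi_1, \psi_2 : A \to B$ are orthogonal ($\psi_1 \perp \psi_2$) if $\psi_1(a)\psi_2(b) = \psi_2(b)\psi_1(a) = 0$ for all $a, b \in A$. *)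

(* Defs.v *)
From HB Require Import structures.
From mathcomp Require Import all_boot all_order all_algebra.
From mathcomp Require Import complex.
From mathcomp Require Import all_classical reals topology normedtype.

Set Implicit Arguments.
Unset Strict Implicit.
Unset Printing Implicit Defensive.

Import Order.TTheory GRing.Theory Num.Theory.
Import numFieldNormedType.Exports.

Local Open Scope ring_scope.

(* MathComp's rings and algebras are unital, so associative algebras without
   a unit are introduced here as modules with a bilinear product [a ** b]. *)
HB.mixin Record Lmodule_isNonunitalAlgebra (K : comNzRingType) A
    of GRing.Lmodule K A := {
  amul : A -> A -> A;
  amulA : associative amul;
  amulDl : forall a b c : A, amul (a + b) c = amul a c + amul b c;
  amulDr : forall a b c : A, amul a (b + c) = amul a b + amul a c;
  amulZl : forall (k : K) (a b : A), amul (k *: a) b = k *: amul a b;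
  amulZr : forall (k : K) (a b : A), amul a (k *: b) = k *: amul a b
}.

#[short(type="nonunitalAlgType")]
HB.structure Definition NonunitalAlgebra (K : comNzRingType) :=
  {A of Lmodule_isNonunitalAlgebra K A & GRing.Lmodule K A}.

Notation "a ** b" := (amul a b) (at level 40, left associativity) : ring_scope.

HB.mixin Record NonunitalAlgebra_isStar (K : numClosedFieldType) A
    of NonunitalAlgebra K A := {
  star : A -> A;
  starK : involutive star;
  starD : forall a b : A, star (a + b) = star a + star b;
  starZ : forall (k : K) (a : A), star (k *: a) = k^* *: star a;
  starM : forall a b : A, star (a ** b) = star b ** star a
}.

#[short(type="starAlgType")]
HB.structure Definition StarAlgebra (K : numClosedFieldType) :=
  {A of NonunitalAlgebra_isStar K A & NonunitalAlgebra K A}.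

(* The norm of a normed module over [R[i]] is valued in [R[i]] (in its
   nonnegative reals), so the norm axioms below are stated there. *)
HB.mixin Record StarAlgebra_isCStar (R : realType) A
    of StarAlgebra R[i] A & CompleteNormedModule R[i] A := {
  normr_amul : forall a b : A, `|a ** b| <= `|a| * `|b|;
  normr_star_amul : forall a : A, `|star a ** a| = `|a| ^+ 2
}.

#[short(type="cstarAlgType")]
HB.structure Definition CStarAlgebra (R : realType) :=
  {A of StarAlgebra_isCStar R A & StarAlgebra R[i] A
      & CompleteNormedModule R[i] A}.

(* [aprod [:: a1; ...; an]] is [a1 ** ... ** an]; an algebra without a unit
   has no empty product, and the value 0 on [::] is a dummy. *)
Definition aprod (K : comNzRingType) (A : nonunitalAlgType K) (s : seq A) : A :=
  if s is a :: s' then foldl amul a s' else 0.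

Definition n_homomorphism (K : comNzRingType) (A B : nonunitalAlgType K)
    (n : nat) (phi : {linear A -> B}) : Prop :=
  forall a : n.-tuple A, phi (aprod a) = aprod [seq phi x | x <- a].

Definition involutive_map (K : numClosedFieldType) (A B : starAlgType K)
    (phi : {linear A -> B}) : Prop :=
  forall a : A, phi (star a) = star (phi a).

Definition star_homomorphism (K : numClosedFieldType) (A B : starAlgType K)
    (psi : {linear A -> B}) : Prop :=
  (forall a b : A, psi (a ** b) = psi a ** psi b) /\ involutive_map psi.

Definition orthogonal_maps (K : comNzRingType) (A B : nonunitalAlgType K)
    (psi1 psi2 : {linear A -> B}) : Prop :=
  forall a b : A, psi1 a ** psi2 b = 0 /\ psi2 b ** psi1 a = 0.

(* Main.v *)
Require Import Defs.
From HB Require Import structures.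
From mathcomp Require Import all_boot all_order all_algebra ring.
From mathcomp Require Import complex.
From mathcomp Require Import all_classical reals topology normedtype sequences.

(* The product [phi a ** phi b] depends only on [a ** b]: if the [a_i ** b_i]
   sum to 0, then [z = \sum_i phi a_i ** phi b_i] is killed on the right by
   products of values of [phi], and the C*-identity forces [z = 0]. Since a
   C*-algebra is spanned by its products, this yields linear maps [Phi k], morally
   [e ^ k phi] for a selfadjoint multiplier [e], with [Phi 0 = phi],
   [Phi j a ** Phi k b = Phi (j + k + 1) (a ** b)], and period [n - 1] in [k]. A
   selfadjoint [e] with [e ^ (n - 1) = 1] satisfies [e ^ 2 = 1], as its non-real
   eigenspaces vanish. If [n] is even then [e = 1]; if [n] is odd then
   [(Phi 1 + phi) / 2] and [(Phi 1 - phi) / 2] are the two homomorphisms.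

   That a selfadjoint [a] of norm at most 1 is a product is proved without
   functional calculus, by the iteration [t := (s + t ^ 2) / 2], which converges
   to [1 - sqrt (1 - s)] whenever [s] acts as a contraction. With [s = a ^ 2] it
   gives [r] such that [a +- i (1 - r)] is unitary, so that
   [1 - a ^ 2 = (1 - r) ^ 2] is a contraction; then [s = 1 - a ^ 2] gives
   [|a| = sqrt (a ^ 2)], and [s = 1 - |a|] gives [sqrt |a|], together with the
   limit [d] of an iteration for [a / sqrt |a|]; finally [a = d sqrt |a|]. *)

Set Implicit Arguments.
Unset Strict Implicit.
Unset Printing Implicit Defensive.

Import Order.TTheory GRing.Theory Num.Theory.
Import numFieldNormedType.Exports.

Local Open Scope ring_scope.
Local Open Scope classical_set_scope.

(** * Algebras and star-algebras without a unit, and linear maps defined on products *)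

Section NonunitalAlgebraTheory.
Variables (K : comNzRingType) (A : nonunitalAlgType K).
Implicit Types a b c : A.

Lemma amul0l a : 0 ** a = 0.
Proof. by apply: (addrI (0 ** a)); rewrite -amulDl !addr0. Qed.

Lemma amul0r a : a ** 0 = 0.
Proof. by apply: (addrI (a ** 0)); rewrite -amulDr !addr0. Qed.

Lemma amulNl a b : (- a) ** b = - (a ** b).
Proof. by rewrite -scaleN1r amulZl scaleN1r. Qed.

Lemma amulNr a b : a ** (- b) = - (a ** b).
Proof. by rewrite -scaleN1r amulZr scaleN1r. Qed.

Lemma amulBl a b c : (a - b) ** c = a ** c - b ** c.
Proof. by rewrite amulDl amulNl. Qed.

Lemma amulBr a b c : a ** (b - c) = a ** b - a ** c.
Proof. by rewrite amulDr amulNr. Qed.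

Lemma amul_suml I (r : seq I) (F : I -> A) a :
  (\sum_(i <- r) F i) ** a = \sum_(i <- r) F i ** a.
Proof.
by elim/big_rec2: _ => [|i x y _ <-]; rewrite ?amul0l ?amulDl.
Qed.

Lemma amul_sumr I (r : seq I) (F : I -> A) a :
  a ** (\sum_(i <- r) F i) = \sum_(i <- r) a ** F i.
Proof.
by elim/big_rec2: _ => [|i x y _ <-]; rewrite ?amul0r ?amulDr.
Qed.

Lemma foldl_amul0 (s : seq A) : foldl amul 0 s = 0.
Proof. by elim: s => //= c s IHs; rewrite amul0l. Qed.

Lemma foldl_amul_sum I (r : seq I) (F : I -> A) (s : seq A) :
  foldl amul (\sum_(i <- r) F i) s = \sum_(i <- r) foldl amul (F i) s.
Proof.
by elim: s F => //= c s IHs F; rewrite amul_suml IHs.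
Qed.

End NonunitalAlgebraTheory.

Definition idempotent_algebra (K : comNzRingType) (A : nonunitalAlgType K) :=
  forall a : A, exists s : seq (A * A), a = \sum_(p <- s) p.1 ** p.2.

(** The form in which the C*-identity of the target enters the algebraic half of the proof. *)
Definition proper_involution (K : numClosedFieldType) (A : starAlgType K) :=
  forall a : A, star a ** a = 0 -> a = 0.

Section Star.
Variables (K : numClosedFieldType) (A : starAlgType K).
Implicit Types a b : A.

Lemma star0 : star 0 = 0 :> A.
Proof. by apply: (addrI (star 0)); rewrite -starD !addr0. Qed.

Lemma starN a : star (- a) = - star a.
Proof. by apply: (addrI (star a)); rewrite -starD !subrr star0. Qed.

Lemma starB a b : star (a - b) = star a - star b.
Proof. by rewrite starD starN. Qed.

Lemma star_sum I (r : seq I) (F : I -> A) :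
  star (\sum_(i <- r) F i) = \sum_(i <- r) star (F i).
Proof. by elim/big_rec2: _ => [|i x y _ <-]; rewrite ?star0 ?starD. Qed.

Lemma proper_involution_r a : proper_involution A -> a ** star a = 0 -> a = 0.
Proof.
move=> hA h; rewrite -[a]starK (hA (star a)) ?star0 //.
by rewrite starK.
Qed.

End Star.

Lemma eq_linear_amul (K : comNzRingType) (A B : nonunitalAlgType K)
    (f g : {linear A -> B}) : idempotent_algebra A ->
  (forall a b, f (a ** b) = g (a ** b)) -> f =1 g.
Proof.
move=> hA fg x; have [s ->] := hA x; rewrite !linear_sum.
by apply: eq_bigr => p _; apply: fg.
Qed.

(** Two decompositions of one element into products differ by a decomposition of 0, so the
    hypothesis makes the value independent of the decomposition chosen. *)
Lemma extend_bilinear (K : comNzRingType) (A B : nonunitalAlgType K)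
    (f g : {linear A -> B}) : idempotent_algebra A ->
  (forall s : seq (A * A), \sum_(p <- s) p.1 ** p.2 = 0 ->
     \sum_(p <- s) f p.1 ** g p.2 = 0) ->
  exists h : {linear A -> B}, forall a b, h (a ** b) = f a ** g b.
Proof.
move=> hA fg0.
have [S SE] := choice hA.
pose h a := \sum_(p <- S a) f p.1 ** g p.2.
have hE s : h (\sum_(p <- s) p.1 ** p.2) = \sum_(p <- s) f p.1 ** g p.2.
  set a := (X in h X); apply/eqP; rewrite eq_sym -subr_eq0; apply/eqP.
  have := fg0 (s ++ [seq (- p.1, p.2) | p <- S a]).
  rewrite !big_cat !big_map /=.
  have -> : \sum_(p <- S a) - p.1 ** p.2 = - a.
    by rewrite [in RHS](SE a) -sumrN; apply: eq_bigr => p _; rewrite amulNl.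
  have -> : \sum_(p <- S a) f (- p.1) ** g p.2 = - h a.
    by rewrite -sumrN; apply: eq_bigr => p _; rewrite linearN amulNl.
  by rewrite subrr; apply.
have hlin : linear h.
  move=> k a b; rewrite {1}(SE a) {1}(SE b).
  pose t := [seq (k *: p.1, p.2) | p <- S a] ++ S b.
  transitivity (h (\sum_(p <- t) p.1 ** p.2)).
    congr h; rewrite big_cat big_map scaler_sumr; congr (_ + _).
    by apply: eq_bigr => p _; rewrite amulZl.
  rewrite hE big_cat big_map scaler_sumr; congr (_ + _).
  by apply: eq_bigr => p _; rewrite linearZ amulZl.
pose hL : {linear A -> B} := HB.pack h (GRing.isLinear.Build K A B *:%R h hlin).
exists hL => a b.
by have := hE [:: (a, b)]; rewrite !big_seq1.
Qed.

(** * The tower of linear maps [Phi k] *)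

Section Tower.
Variables (K : numClosedFieldType) (A B : starAlgType K).
Variables (phi : {linear A -> B}) (N : nat).
Hypotheses (hA : idempotent_algebra A) (hB : proper_involution B).
Hypothesis N_gt0 : (0 < N)%N.
Hypothesis phiM : n_homomorphism N.+1 phi.
Hypothesis phi_star : involutive_map phi.

(* [absorbs m f] says that [f] behaves like [e ^ k phi] with [k + m] a multiple
   of [N], where [e] is the multiplier sending [phi (a ** b)] to
   [phi a ** phi b] *)
Definition absorbs m (f : {linear A -> B}) := forall a (s : seq A),
  size s = m -> foldl amul (f a) (map phi s) = phi (foldl amul a s).

Lemma absorbs_phi : absorbs N phi.
Proof.
move=> a s ss; have sz : size (a :: s) == N.+1 by rewrite /= ss.
exact: esym (phiM (Tuple sz)).
Qed.

Lemma absorbs_step m f : absorbs m f ->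
  exists2 h : {linear A -> B},
    (exists m', absorbs m' h) & forall a b, h (a ** b) = f a ** phi b.
Proof.
(* If [m = 0] then [f] agrees with [phi], which absorbs [N > 0] factors. *)
move=> fm; have {m fm} [m fm] : exists m, absorbs m.+1 f.
  case: m fm => [|m] fm; last by exists m.
  exists N.-1; rewrite prednK // => a s ss.
  by have /= -> := fm a [::] erefl; rewrite absorbs_phi.
have wd (s : seq (A * A)) : \sum_(p <- s) p.1 ** p.2 = 0 ->
     \sum_(p <- s) f p.1 ** phi p.2 = 0.
  move=> s0; set z := (X in X = 0).
  have zm (t : seq A) : size t = m -> foldl amul z (map phi t) = 0.
    move=> tm; rewrite foldl_amul_sum.
    transitivity (\sum_(p <- s) phi (foldl amul (p.1 ** p.2) t)).
      by apply: eq_bigr => p _; rewrite -(fm p.1 (p.2 :: t)) //= tm.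
    by rewrite -linear_sum -foldl_amul_sum s0 foldl_amul0 linear0.
  have z1 c : z ** phi c = 0.
    (* Factors are peeled off one at a time: for [w = v ** phi d], the product [w ** star w] begins
       with [w ** phi (star d)], which is 0 by induction, so [w = 0]. *)
    have : forall k (t : seq A) d, (k + size t)%N = m ->
        foldl amul z (map phi t) ** phi d = 0.
      elim=> [|k IHk] t d kt.
        by rewrite zm // amul0l.
      apply: (proper_involution_r hB).
      have := IHk (rcons t d); rewrite size_rcons addnS -addSn.
      rewrite map_rcons foldl_rcons => /(_ _ kt) IH.
      by rewrite starM -phi_star amulA IH amul0l.
    by move=> /(_ m [::] c); rewrite addn0; apply.
  apply: (proper_involution_r hB).
  rewrite {2}/z star_sum amul_sumr big1 // => p _.
  by rewrite starM -phi_star amulA z1 amul0l.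
have [h hE] := extend_bilinear hA wd.
exists h => //; exists m => x s sm.
have [r ->] := hA x; rewrite linear_sum !foldl_amul_sum linear_sum.
by apply: eq_bigr => p _; rewrite hE -(fm p.1 (p.2 :: s)) //= sm.
Qed.

Lemma tower_exists : exists Phi : nat -> {linear A -> B},
  Phi 0 = phi /\ forall k a b, Phi k.+1 (a ** b) = Phi k a ** phi b.
Proof.
(* In this subtype [absorbs_step] always provides a successor, so it can be iterated. *)
pose T := {f : {linear A -> B} | exists m, absorbs m f}.
have [next nextE] : {next : T -> T &
    forall f a b, sval (next f) (a ** b) = sval f a ** phi b}.
  apply: (@choice _ _ (fun f g : T =>
    forall a b, sval g (a ** b) = sval f a ** phi b)) => -[f fm] /=.
  have [m {}fm] := fm.
  by have [h hm hE] := absorbs_step fm; exists (exist _ h hm).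
pose Phi k := iter k next (exist _ phi (ex_intro _ N absorbs_phi)).
by exists (fun k => sval (Phi k)); split=> // k a b; rewrite nextE.
Qed.

Variable Phi : nat -> {linear A -> B}.
Hypothesis Phi0 : Phi 0 = phi.
Hypothesis PhiS : forall k a b, Phi k.+1 (a ** b) = Phi k a ** phi b.

Lemma towerM j k a b : Phi j a ** Phi k b = Phi (j + k).+1 (a ** b).
Proof.
elim: k b => [|k IHk] b; first by rewrite Phi0 addn0 PhiS.
have [s ->] := hA b; rewrite linear_sum !amul_sumr linear_sum.
by apply: eq_bigr => p _; rewrite PhiS amulA IHk addnS amulA [RHS]PhiS.
Qed.

Lemma tower_star k : involutive_map (Phi k).
Proof.
elim: k => [|k IHk] a; first by rewrite Phi0.
have [s ->] := hA a; rewrite star_sum !linear_sum star_sum.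
apply: eq_bigr => p _; rewrite PhiS !starM -phi_star -IHk.
by rewrite -Phi0 towerM add0n.
Qed.

(** Each level uses up one of the [N] factors that [phi] absorbs; at [k = N] none is left, which
    gives [Phi N = phi]. *)
Lemma tower_absorbs k m : (k + m)%N = N -> absorbs m (Phi k).
Proof.
elim: k m => [|k IHk] m; first by rewrite add0n Phi0 => ->; apply: absorbs_phi.
rewrite addSnnS => /IHk fm a s sm.
have [r ->] := hA a; rewrite linear_sum !foldl_amul_sum linear_sum.
by apply: eq_bigr => p _; rewrite PhiS -(fm p.1 (p.2 :: s)) //= sm.
Qed.

Lemma tower_periodic k a : Phi (k + N) a = Phi k a.
Proof.
elim: k a => [|k IHk] a.
  rewrite add0n Phi0.
  by have /= -> := tower_absorbs (addn0 N) a (s := [::]) erefl.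
move: a; apply: (eq_linear_amul hA) => a b.
by rewrite addSn !PhiS IHk.
Qed.

End Tower.

(** * Orbits of a selfadjoint operator, and their eigenvalues *)

Section Hankel.
Variables (K : numClosedFieldType) (B : starAlgType K).
Hypothesis hB : proper_involution B.

(* Sequences [y] as orbits [k |-> e ^ k (y 0)] of a selfadjoint operator [e]. *)
Definition hankel (y : nat -> B) :=
  forall j k, star (y j.+1) ** y k = star (y j) ** y k.+1.

(** The orbit of [e - w] applied to [y]. *)
Definition shift_sub (w : K) (y : nat -> B) k := y k.+1 - w *: y k.

Lemma shift_subC w w' y :
  shift_sub w (shift_sub w' y) = shift_sub w' (shift_sub w y).
Proof.
apply/funext => k; rewrite /shift_sub !scalerBr !scalerA (mulrC w) !opprB.
by rewrite addrACA [RHS]addrACA [in RHS](addrC (- _)).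
Qed.

Lemma foldr_shift_subC (r : seq K) w y :
  shift_sub w (foldr shift_sub y r) = foldr shift_sub (shift_sub w y) r.
Proof. by elim: r => //= w' r <-; rewrite shift_subC. Qed.

Lemma hankel_shift_sub w y : hankel y -> hankel (shift_sub w y).
Proof.
move=> hy j k; rewrite /shift_sub !starB !starZ.
by rewrite !(amulBl, amulBr, amulZl, amulZr) !hy.
Qed.

(** The diagonal Hankel relation reads [w^* *: q = w *: q] with [q = star (y k) ** y k]. *)
Lemma hankel_eigen_nonreal w y : hankel y -> w^* != w ->
  shift_sub w y = (fun=> 0) -> y = (fun=> 0).
Proof.
move=> hy wr y0; apply/funext => k.
have yS : y k.+1 = w *: y k.
  by apply/eqP; rewrite -subr_eq0; apply/eqP; exact: (congr1 (@^~ k) y0).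
apply: hB; have := hy k k.
rewrite yS starZ amulZl amulZr => /eqP; rewrite -subr_eq0 -scalerBl.
by rewrite scaler_eq0 subr_eq0 (negbTE wr) => /eqP.
Qed.

(** A selfadjoint operator has no Jordan blocks: the square of [(e - w) y] is [y] paired with
    [(e - w) ^ 2 y]. *)
Lemma hankel_eigen_real w y : hankel y -> w^* = w ->
  shift_sub w (shift_sub w y) = (fun=> 0) -> shift_sub w y = (fun=> 0).
Proof.
move=> hy wr y0; apply/funext => k; apply: hB.
have zS j : shift_sub w y j.+1 = w *: shift_sub w y j.
  by apply/eqP; rewrite -subr_eq0; apply/eqP; exact: (congr1 (@^~ j) y0).
rewrite {1}/shift_sub starB starZ wr amulBl amulZl.
have -> : star (y k.+1) ** shift_sub w y k = star (y k) ** shift_sub w y k.+1.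
  by rewrite {1 2}/shift_sub !amulBr !amulZr !hy.
by rewrite zS amulZr subrr.
Qed.

Lemma hankel_roots (r : seq K) y : hankel y ->
  (forall w, w \in r -> w^* = w -> w ^+ 2 = 1) ->
  foldr shift_sub y r = (fun=> 0) -> shift_sub 1 (shift_sub (-1) y) = (fun=> 0).
Proof.
elim: r y => [|w r IHr] y hy rr /=.
  by move=> ->; apply/funext => k; rewrite /shift_sub !(scaler0, subr0).
rewrite foldr_shift_subC.
have rr' w' : w' \in r -> w'^* = w' -> w' ^+ 2 = 1.
  by move=> w'r; apply: rr; rewrite inE w'r orbT.
move=> /(IHr _ (hankel_shift_sub w hy) rr').
rewrite (shift_subC (-1) w) (shift_subC 1 w) => zw.
have hz := hankel_shift_sub 1 (hankel_shift_sub (-1) hy).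
have [wR|wNR] := eqVneq w^* w; last exact: hankel_eigen_nonreal wNR zw.
have /eqP := rr w (mem_head _ _) wR; rewrite sqrf_eq1 => /orP[] /eqP wE.
  move: zw; rewrite wE; apply: hankel_eigen_real (hankel_shift_sub _ hy) _.
  by rewrite rmorph1.
move: zw; rewrite wE (shift_subC 1).
apply: hankel_eigen_real (hankel_shift_sub _ hy) _.
by rewrite rmorphN rmorph1.
Qed.

Lemma sum_scale_shift_sub (p : {poly K}) w y k m : (size p <= m)%N ->
  \sum_(i < m.+1) (p * ('X - w%:P))`_i *: y (k + i)%N =
  \sum_(i < m) p`_i *: shift_sub w y (k + i)%N.
Proof.
move=> pm; under [RHS]eq_bigr do rewrite /shift_sub scalerBr scalerA.
rewrite sumrB; under [LHS]eq_bigr do rewrite mulrBr coefB coefMC scalerBl.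
rewrite sumrB; congr (_ - _).
  rewrite big_ord_recl coefMX eqxx scale0r add0r; apply: eq_bigr => i _.
  by rewrite coefMX lift0 /= addnS.
by rewrite big_ord_recr /= [p`_m]nth_default // mul0r scale0r addr0.
Qed.

Lemma foldr_shift_subE (r : seq K) y k :
  foldr shift_sub y r k =
  \sum_(i < (size r).+1) (\prod_(w <- r) ('X - w%:P))`_i *: y (k + i)%N.
Proof.
elim: r y k => [|w r IHr] y k /=.
  by rewrite big_ord1 big_nil coef1 addn0 scale1r.
by rewrite foldr_shift_subC IHr big_cons mulrC sum_scale_shift_sub //
  size_prod_XsubC.
Qed.

Lemma hankel_periodic y N : (0 < N)%N -> hankel y ->
  (forall k, y (k + N)%N = y k) -> forall k, y k.+2 = y k.
Proof.
move=> N0 hy yN k.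
have [r rE] := closed_field_poly_normal ('X^N - 1 : {poly K}).
rewrite (monicP (monicXnsubC 1 N0)) scale1r in rE.
have sr : size r = N.
  by apply: succn_inj; rewrite -(size_prod_XsubC r id) -rE size_XnsubC.
(* The product over the roots of [X ^ N - 1] sends [y] to [y (k + N) - y k]. *)
have r0 : foldr shift_sub y r = (fun=> 0).
  apply/funext => j; rewrite foldr_shift_subE -rE sr.
  rewrite big_ord_recr /= (bigD1 (Ordinal N0)) //= big1 => [|i iN0].
    rewrite !coefB !coefXn !coef1 eqxx (gtn_eqF N0) (ltn_eqF N0).
    by rewrite sub0r subr0 scaleN1r scale1r yN addn0 addr0 addNr.
  rewrite coefB coefXn coef1 (ltn_eqF (ltn_ord i)).
  have /negbTE -> : val i != 0%N by [].
  by rewrite subrr scale0r.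
(* A real root of unity has absolute value 1. *)
have rr w : w \in r -> w^* = w -> w ^+ 2 = 1.
  rewrite -root_prod_XsubC -rE rootE !hornerE subr_eq0 => /eqP wN wR.
  have wr : w \is Num.real by apply/CrealP.
  rewrite -real_normK //; apply/eqP; rewrite sqrp_eq1 //.
  by rewrite -(pexpr_eq1 N0) // -normrX wN normr1.
have /(congr1 (@^~ k)) := hankel_roots hy rr r0.
rewrite /shift_sub !scale1r !scaleN1r !opprK opprD addrA addrK => /eqP.
by rewrite subr_eq0 => /eqP.
Qed.
End Hankel.

(** * The even and odd cases over star-algebras, with [n = N + 1] *)

Theorem involutive_n_homomorphism (K : numClosedFieldType) (A B : starAlgType K)
    (phi : {linear A -> B}) (N : nat) : idempotent_algebra A ->
  proper_involution B -> (0 < N)%N -> n_homomorphism N.+1 phi ->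
  involutive_map phi ->
  (odd N -> star_homomorphism phi) /\
  (~~ odd N -> exists psi1 psi2 : {linear A -> B},
      [/\ star_homomorphism psi1, star_homomorphism psi2,
          orthogonal_maps psi1 psi2
        & forall a : A, phi a = psi1 a - psi2 a]).
Proof.
move=> hA hB N0 phiM phi_star.
have [Phi [Phi0 PhiS]] := tower_exists hA hB N0 phiM phi_star.
have PM := towerM hA Phi0 PhiS.
have Pstar := tower_star hA phi_star Phi0 PhiS.
have PN := tower_periodic hA phiM Phi0 PhiS.
have P2 k a : Phi k.+2 a = Phi k a.
  (* Both sides of the Hankel relation are [Phi (j + k + 2) (star a ** a)]. *)
  have := hankel_periodic hB (y := fun k => Phi k a) N0.
  apply=> [i j|i]; last exact: PN.
  by rewrite -!Pstar !PM addSn addnS.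
split=> [Nodd|_].
  (* Periods 2 and [N] combine, for [N] odd, to period 1. *)
  have P1 a : Phi 1 a = Phi 0 a.
    rewrite -(PN 0) add0n -(odd_double_half N) Nodd.
    by elim: N./2 => [//|h ->]; rewrite doubleS !addnS P2.
  by split=> // a b; rewrite -Phi0 PM -P1.
(* Since [e ^ 2 = 1], [Phi 1] is multiplicative; [psi1] and [psi2] are its parts in the eigenspaces
   1 and -1 of [e]. *)
pose psi1 : {linear A -> B} := 2^-1 \*: (Phi 1 \+ Phi 0).
pose psi2 : {linear A -> B} := 2^-1 \*: (Phi 1 \- Phi 0).
have M00 a b : Phi 0 a ** Phi 0 b = Phi 1 (a ** b) by rewrite PM.
have M01 a b : Phi 0 a ** Phi 1 b = Phi 0 (a ** b) by rewrite PM P2.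
have M10 a b : Phi 1 a ** Phi 0 b = Phi 0 (a ** b) by rewrite PM P2.
have M11 a b : Phi 1 a ** Phi 1 b = Phi 1 (a ** b) by rewrite PM P2.
have half (x : B) : 2^-1 *: (x + x) = x.
  by rewrite -mulr2n -[x *+ 2]scaler_nat scalerA mulVf ?scale1r // pnatr_eq0.
have halfJ : (2^-1 : K)^* = 2^-1 by rewrite fmorphV rmorph_nat.
exists psi1, psi2; split.
- split=> [a b|a] /=; last by rewrite starZ starD halfJ !Pstar.
  rewrite amulZl amulZr amulDl !amulDr M00 M01 M10 M11.
  by rewrite [Phi 0 _ + _]addrC half.
- split=> [a b|a] /=; last by rewrite starZ starB halfJ !Pstar.
  rewrite amulZl amulZr amulBl !amulBr M00 M01 M10 M11.
  by rewrite opprB half.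
- move=> a b /=; rewrite !amulZl !amulZr amulDl amulBl !amulBr !amulDr.
  rewrite !(M00, M01, M10, M11) !addrA !addrNK opprD addrA addrK.
  by rewrite !subrr !scaler0.
- move=> a /=; rewrite -scalerBr opprB [Phi 1 a + _]addrC addrACA subrr addr0.
  by rewrite half Phi0.
Qed.

(** * The scalar sequence that dominates the square-root iteration *)

Section Majorant.
Variable F : numFieldType.

(** The iteration [t := (s + t ^ 2) / 2] at the extreme value [s = 1]. *)
Fixpoint majorant k : F :=
  if k is k'.+1 then 2^-1 * (1 + majorant k' ^+ 2) else 0.

Lemma majorant_bounds k : 0 <= majorant k <= 1.
Proof.
elim: k => [|k /andP[m0 m1]] /=; first by rewrite lexx ler01.
rewrite mulr_ge0 ?invr_ge0 ?addr_ge0 ?exprn_ge0 //=.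
by rewrite ler_pdivrMl ?ltr0n // mulr1 (natrD _ 1 1) lerD2l expr_le1.
Qed.

Lemma majorant_ge0 k : 0 <= majorant k.
Proof. by have /andP[] := majorant_bounds k. Qed.

Lemma majorant_le1 k : majorant k <= 1.
Proof. by have /andP[] := majorant_bounds k. Qed.

Lemma majorant_incr k : majorant k <= majorant k.+1.
Proof.
rewrite /= ler_pdivlMl ?ltr0n // -subr_ge0.
suff -> : 1 + majorant k ^+ 2 - 2 * majorant k = (1 - majorant k) ^+ 2.
  by rewrite exprn_ge0 // subr_ge0 majorant_le1.
by rewrite sqrrB expr1n mul1r mulr_natl addrAC.
Qed.

Lemma majorant_homo j k : (j <= k)%N -> majorant j <= majorant k.
Proof. exact: (homo_leq (@lexx _ _) (@le_trans _ _) majorant_incr). Qed.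

(** The gap [d] to 1 evolves by [d := d - d ^ 2 / 2], and [2 / (k + 2)] decreases more slowly than
    this recursion. *)
Lemma majorant_rate k : 1 - majorant k <= 2 / k.+2%:R.
Proof.
elim: k => [|k IHk] /=; first by rewrite subr0 divff ?pnatr_eq0.
set d := 1 - majorant k in IHk.
have d0 : 0 <= d by rewrite subr_ge0 majorant_le1.
have d1 : d <= 1 by rewrite lerBlDr lerDl majorant_ge0.
have -> : 1 - 2^-1 * (1 + majorant k ^+ 2) = d - 2^-1 * d ^+ 2.
  by rewrite /d; field; rewrite ?pnatr_eq0.
(* [d - d ^ 2 / 2] increases with [d] on [[0, 1]] *)
set e : F := 2 / k.+2%:R in IHk.
have e1 : e <= 1 by rewrite ler_pdivrMr ?ltr0n // mul1r ler_nat.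
apply: (@le_trans _ _ (e - 2^-1 * e ^+ 2)).
  rewrite -subr_ge0.
  have -> : e - 2^-1 * e ^+ 2 - (d - 2^-1 * d ^+ 2)
     = (e - d) * (2^-1 * ((1 - e) + (1 - d))) by field; rewrite ?pnatr_eq0.
  apply: mulr_ge0; first by rewrite subr_ge0.
  by rewrite mulr_ge0 ?invr_ge0 // addr_ge0 // subr_ge0.
rewrite -subr_ge0 /e.
have -> : 2 / k.+3%:R - (2 / k.+2%:R - 2^-1 * (2 / k.+2%:R) ^+ 2)
   = 2 / (k.+3%:R * k.+2%:R ^+ 2) :> F.
  rewrite -(natr1 k.+2) -(natr1 k.+1) -(natr1 k).
  field; rewrite !natr1 ?pnatr_eq0 //.
by rewrite divr_ge0 ?mulr_ge0 ?exprn_ge0.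
Qed.
End Majorant.

Lemma scale_cvg1 (K : numFieldType) (V : normedModType K) (m : nat -> K)
    (u : nat -> V) (x : V) :
  (forall e, 0 < e -> \forall k \near \oo, `|1 - m k| < e) ->
  u @ \oo --> x -> (fun k => m k *: u k) @ \oo --> x.
Proof.
move=> m1 ux; rewrite -[x]scale1r; apply: cvgZ => //.
by apply/cvgrPdist_lt => e e0; apply: m1.
Qed.

(** * Norms and limits in a C*-algebra *)

Section CStar.
Variables (R : realType) (A : cstarAlgType R).
Local Notation C := R[i].
Implicit Types (a b x y z : A) (u v : nat -> A).

Lemma cstar_proper : proper_involution A.
Proof.
move=> a /(congr1 Num.norm); rewrite normr_star_amul normr0 => /eqP.
by rewrite expf_eq0 /= normr_eq0 => /eqP.
Qed.

Lemma normr_star a : `|star a| = `|a|.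
Proof.
have le b : `|b| <= `|star b|.
  have [->|b0] := eqVneq b 0; first by rewrite normr0.
  have bp : 0 < `|b| by rewrite normr_gt0.
  by rewrite -(ler_pM2r bp) -expr2 -normr_star_amul normr_amul.
by apply/eqP; rewrite eq_le le andbT -{2}[a]starK le.
Qed.

Lemma normr_selfadjoint_sqr a : star a = a -> `|a ** a| = `|a| ^+ 2.
Proof. by move=> {1}<-; rewrite normr_star_amul. Qed.

Lemma cvg_amul u v x y : u @ \oo --> x -> v @ \oo --> y ->
  (fun k => u k ** v k) @ \oo --> x ** y.
Proof.
move=> /cvgrPdist_lt ux /cvgrPdist_lt vy; apply/cvgrPdist_lt => e e0.
have x0 : 0 < `|x| + 1 by rewrite ltr_wpDl.
have y0 : 0 < `|y| + 1 by rewrite ltr_wpDl.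
have e2 : 0 < e / 2 by rewrite divr_gt0.
near=> k.
have -> : x ** y - u k ** v k = x ** (y - v k) + (x - u k) ** v k.
  by rewrite amulBr amulBl addrA addrNK.
rewrite [e in _ < e]splitr (le_lt_trans (ler_normD _ _)) //.
rewrite ltrD // (le_lt_trans (normr_amul _ _)) //.
  apply: (@le_lt_trans _ _ ((`|x| + 1) * `|y - v k|)).
    by rewrite ler_wpM2r // lerDl.
  rewrite mulrC -ltr_pdivlMr //.
  by near: k; apply: vy; rewrite divr_gt0.
apply: (@le_lt_trans _ _ (`|x - u k| * (`|y| + 1))).
  rewrite ler_wpM2l // -[v k](addrNK y) addrC (le_trans (ler_normD _ _)) //.
  rewrite lerD2l distrC ltW //.
  by near: k; apply: vy.
rewrite -ltr_pdivlMr //.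
by near: k; apply: ux; rewrite divr_gt0.
Unshelve. all: by end_near. Qed.

Lemma cvg_star u x : u @ \oo --> x -> (fun k => star (u k)) @ \oo --> star x.
Proof.
move=> /cvgrPdist_lt ux; apply/cvgrPdist_lt => e e0.
near=> k; rewrite -starB normr_star; near: k; exact: ux.
Unshelve. all: by end_near. Qed.

Lemma cvg_uniq u x y : u @ \oo --> x -> u @ \oo --> y -> x = y.
Proof. apply: cvg_unique; exact: norm_hausdorff. Qed.

Lemma normr_cvg_le u x (M : C) :
  u @ \oo --> x -> (forall k, `|u k| <= M) -> `|x| <= M.
Proof.
move=> /cvgrPdist_lt ux uM; apply/ler_addgt0Pr => e e0.
near \oo => k; rewrite -[x](addrNK (u k)) (le_trans (ler_normD _ _)) //.
rewrite addrC lerD // ltW //.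
by near: k; apply: ux.
Unshelve. all: by end_near. Qed.

Lemma majorant_near (e : C) : 0 < e ->
  \forall k \near \oo, 1 - majorant C k < e.
Proof.
move=> e0; have er : e = (complex.Re e)%:C%C by rewrite RRe_real ?gtr0_real.
have re0 : 0 < complex.Re e by move: e0; rewrite {1}er ltcR.
have := archi_boundP (ltW (divr_gt0 (@ltr0n R 2) re0)).
set N := Num.bound _ => hN.
near=> k; apply: le_lt_trans (majorant_rate _ k) _.
rewrite ltr_pdivrMr ?ltr0n // mulrC -ltr_pdivrMr //.
have -> : 2 / e = (2 / complex.Re e)%:C%C.
  by rewrite {1}er rmorphM fmorphV rmorph_nat.
have -> : k.+2%:R = (k.+2%:R : R)%:C%C by rewrite rmorph_nat.
rewrite ltcR (lt_le_trans hN) // ler_nat.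
by rewrite !leqW //; near: k; exact: nbhs_infty_ge.
Unshelve. all: by end_near. Qed.

Lemma cvg_majorantZ (mu : C) u x : u @ \oo --> x ->
  (fun k => (mu * majorant C k) *: u k) @ \oo --> mu *: x.
Proof.
move=> ux; under eq_fun do rewrite -scalerA.
apply: cvgZl_tmp; apply: (scale_cvg1 _ ux) => e e0; near=> k.
rewrite ger0_norm ?subr_ge0 ?majorant_le1 //.
by near: k; apply: majorant_near.
Unshelve. all: by end_near. Qed.

Lemma majorant_cauchy u :
  (forall j k, (j <= k)%N ->
     `|u k - u j| <= 2 * (majorant C k - majorant C j)) ->
  exists x, u @ \oo --> x.
Proof.
move=> hu; suff /cauchy_cvgP : cauchy (u @ \oo) by exists (lim (u @ \oo)).
apply: cauchy_exP => e e0; have e2 : 0 < e / 2 by rewrite divr_gt0.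
near \oo => j; exists (u j).
suff : \forall k \near \oo, ball (u j) e (u k) by [].
near=> k; rewrite -ball_normE /= distrC (le_lt_trans (hu j k _)) //.
  by near: k; exact: nbhs_infty_ge.
rewrite mulrC -ltr_pdivlMr // (@le_lt_trans _ _ (1 - majorant C j)) //.
  by rewrite lerD2r majorant_le1.
by near: j; apply: majorant_near.
Unshelve. all: by end_near. Qed.

End CStar.

(** * The unitization acting on the algebra, and the square-root iteration in it *)

Section Unitization.
Variables (K : comNzRingType) (A : nonunitalAlgType K).
Implicit Types (p q : K^o * A) (y z : A).

(* Pairs [(l, x)] stand for the element [l + x] of the unitization. *)
Definition umul p q : K^o * A :=
  ((p.1 : K) * (q.1 : K), (p.1 : K) *: q.2 + (q.1 : K) *: p.2 + p.2 ** q.2).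

(** Left multiplication by [l + x]; bounds on this action replace a norm on the unitization. *)
Definition uact p y := (p.1 : K) *: y + p.2 ** y.

Lemma uactD p q y : uact (p + q) y = uact p y + uact q y.
Proof. by rewrite /uact scalerDl amulDl addrACA. Qed.

Lemma uactZ k p y : uact (k *: p) y = k *: uact p y.
Proof. by rewrite /uact scalerDr amulZl scalerA. Qed.

Lemma uactB p q y : uact (p - q) y = uact p y - uact q y.
Proof. by rewrite -scaleN1r uactD uactZ scaleN1r. Qed.

Lemma uactBr p y z : uact p (y - z) = uact p y - uact p z.
Proof. by rewrite /uact scalerBr amulBr opprD addrACA. Qed.

Lemma uact_umul p q y : uact (umul p q) y = uact p (uact q y).
Proof.
rewrite /uact /umul /= !(amulDl, amulDr, amulZl, amulZr, scalerDr) scalerA.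
by rewrite amulA -!addrA.
Qed.

End Unitization.

Section RootSequence.
Variables (K : numFieldType) (A : nonunitalAlgType K).

(* Tends to [1 - sqrt (1 - s)]; it is used for [s = (0, x)] and [s = (1, x)]. *)
Fixpoint root_seq (s : K^o * A) k : K^o * A :=
  if k is k'.+1 then 2^-1 *: (s + umul (root_seq s k') (root_seq s k')) else 0.

Lemma root_seq1 (b : bool) x k :
  (root_seq (b%:R, x) k).1 = b%:R * majorant K k.
Proof.
elim: k => [|k /= ->]; first by rewrite /= mulr0.
case: b; rewrite /GRing.scale /= ?mul1r //.
by rewrite !mul0r addr0 mulr0.
Qed.

Lemma root_seq2 (b : bool) x k (y := (root_seq (b%:R, x) k).2)
    (l := b%:R * majorant K k) :
  (root_seq (b%:R, x) k.+1).2 = 2^-1 *: (x + (l *: y + l *: y + y ** y)).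
Proof. by rewrite /= root_seq1. Qed.

End RootSequence.

(** * Convergence of the square-root iteration *)

Section CStarRoot.
Variables (R : realType) (A : cstarAlgType R).
Local Notation C := R[i].
Implicit Types (a b x y z : A) (u v : nat -> A).

(** Take [y = star x] and apply the C*-identity. *)
Lemma normr_le_op x (M : C) :
  0 <= M -> (forall y, `|x ** y| <= M * `|y|) -> `|x| <= M.
Proof.
move=> M0 xM; have [->|x0] := eqVneq x 0; first by rewrite normr0.
have xp : 0 < `|x| by rewrite normr_gt0.
rewrite -(ler_pM2r xp) -expr2; have := xM (star x).
by rewrite -{1}[x]starK normr_star_amul normr_star.
Qed.

Lemma half_norm (x y : A) (M N : C) :
  `|x| <= M -> `|y| <= N -> `|2^-1 *: (x + y)| <= 2^-1 * (M + N).
Proof.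
move=> xM yN; rewrite normrZ ger0_norm ?invr_ge0 // ler_wpM2l ?invr_ge0 //.
exact: le_trans (ler_normD _ _) (lerD xM yN).
Qed.

Section Contraction.
Variables (b : bool) (s : A).
Let t := root_seq (b%:R : C^o, s).
Let m := majorant C.
Hypothesis s_contr : forall y, `|uact (b%:R, s) y| <= `|y|.

Lemma root_seqS k y : uact (t k.+1) y =
  2^-1 *: (uact (b%:R, s) y + uact (t k) (uact (t k) y)).
Proof. by rewrite /t /= uactZ uactD uact_umul. Qed.

Lemma root_seq_bound k y : `|uact (t k) y| <= m k * `|y|.
Proof.
elim: k y => [|k IHk] y.
  by rewrite /uact scale0r amul0l addr0 normr0 mul0r.
rewrite root_seqS -mulrA mulrDl mul1r; apply: half_norm => //.
apply: le_trans (IHk _) _.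
by rewrite expr2 -mulrA ler_wpM2l // majorant_ge0.
Qed.

Lemma root_seq_step k y :
  `|uact (t k.+1) y - uact (t k) y| <= (m k.+1 - m k) * `|y|.
Proof.
elim: k y => [|k IHk] y.
  have -> : uact (t 0) y = 0 by rewrite /uact scale0r amul0l addr0.
  by rewrite !subr0; apply: root_seq_bound.
(* Here [p ^ 2 - q ^ 2 = p (p - q) + (p - q) q], which needs no commutation; [majorant] satisfies
   the same identity. *)
have -> : uact (t k.+2) y - uact (t k.+1) y = 2^-1 *:
    (uact (t k.+1) (uact (t k.+1) y - uact (t k) y)
     + (uact (t k.+1) (uact (t k) y) - uact (t k) (uact (t k) y))).
  rewrite [uact (t k.+2) y]root_seqS [X in _ - X = _]root_seqS -scalerBr.
  by rewrite opprD addrACA subrr add0r uactBr addrA addrNK.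
have -> : (m k.+2 - m k.+1) * `|y| = 2^-1 *
    (m k.+1 * ((m k.+1 - m k) * `|y|) + (m k.+1 - m k) * (m k * `|y|)).
  have mS i : m i.+1 = 2^-1 * (1 + m i ^+ 2) by [].
  by rewrite [m k.+2]mS [X in _ - X]mS; ring.
have d0 : 0 <= m k.+1 - m k by rewrite subr_ge0 majorant_incr.
apply: half_norm.
  apply: le_trans (root_seq_bound _ _) _.
  by rewrite ler_wpM2l ?majorant_ge0.
apply: le_trans (IHk _) _.
by rewrite ler_wpM2l ?root_seq_bound.
Qed.

Lemma root_seq_diff j k y : (j <= k)%N ->
  `|uact (t k - t j) y| <= (m k - m j) * `|y|.
Proof.
move=> jk; rewrite -(subnK jk); elim: (k - j)%N => [|i IHi].
  by rewrite add0n !subrr mul0r /uact scale0r amul0l addr0 normr0.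
rewrite addSn -(subrKA (t (i + j)%N)) -(subrKA (m (i + j)%N)) uactD mulrDl.
apply: le_trans (ler_normD _ _) (lerD _ IHi).
by rewrite uactB; apply: root_seq_step.
Qed.

Lemma root_seq_cauchy j k : (j <= k)%N ->
  `|(t k).2 - (t j).2| <= 2 * (m k - m j).
Proof.
move=> jk; have d0 : 0 <= m k - m j by rewrite subr_ge0 majorant_homo.
apply: normr_le_op => [|y]; first by rewrite mulr_ge0.
have -> : ((t k).2 - (t j).2) ** y =
    uact (t k - t j) y - ((t k).1 - (t j).1 : C) *: y.
  by rewrite /uact [RHS]addrC addKr.
(* One copy of [m k - m j] bounds the action of the difference, the other its scalar coordinate. *)
rewrite (mulr_natl _ 2) mulr2n mulrDl.
apply: le_trans (ler_normB _ _) _; apply: lerD (root_seq_diff _ jk) _.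
rewrite normrZ ler_wpM2r // /t !root_seq1 -mulrBr normrM (ger0_norm d0).
by case: b; rewrite ?normr1 ?normr0 ?mul1r ?mul0r.
Qed.

(** The equation is the fixed-point relation [2 (b + x) = (b + s) + (b + x) ^ 2], simplified by
    [b ^ 2 = b]. *)
Lemma root_seq_cvg : exists x,
  [/\ (fun k => (t k).2) @ \oo --> x,
      x + x = s + (b%:R *: x + b%:R *: x + x ** x)
    & forall y, `|uact (b%:R, x) y| <= `|y|].
Proof.
have [x tx] := majorant_cauchy root_seq_cauchy.
exists x; split=> // [|y].
  have tSx : (fun k => (t k.+1).2) @ \oo --> x.
    by rewrite (cvg_shiftS (fun k => (t k).2)).
  suff xE : x = 2^-1 *: (s + (b%:R *: x + b%:R *: x + x ** x)).
    rewrite -mulr2n -[x *+ 2]scaler_nat {1}xE scalerA divff ?scale1r //.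
    by rewrite pnatr_eq0.
  apply: cvg_uniq tSx _.
  under eq_fun do rewrite root_seq2.
  apply: cvgZl_tmp; apply: cvgD; first exact: cvg_cst.
  apply: cvgD; last exact: cvg_amul.
  by apply: cvgD; apply: cvg_majorantZ.
have ty : (fun k => uact (t k) y) @ \oo --> uact (b%:R, x) y.
  rewrite /uact; under eq_fun do rewrite root_seq1.
  apply: cvgD; last by apply: cvg_amul tx (cvg_cst _).
  by apply: cvg_majorantZ; apply: cvg_cst.
apply: (normr_cvg_le ty) => k; apply: le_trans (root_seq_bound _ _) _.
by rewrite -[leRHS]mul1r ler_wpM2r // majorant_le1.
Qed.

End Contraction.
End CStarRoot.

(** * Factorization of selfadjoint elements *)

Section CStarFactorization.
Variables (R : realType) (A : cstarAlgType R).
Local Notation C := R[i].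
Implicit Types (a b x y z : A) (u v : nat -> A).

Lemma majorantJ k : (majorant C k)^* = majorant C k.
Proof. by apply/CrealP; rewrite ger0_real ?majorant_ge0. Qed.

Lemma halfJ : (2^-1 : C)^* = 2^-1.
Proof. by rewrite fmorphV rmorph_nat. Qed.

(* The selfadjoint elements of the bicommutant of [a], which commute with each
   other. *)
Definition bicomm a x :=
  star x = x /\ forall y, a ** y = y ** a -> x ** y = y ** x.

Section Bicommutant.
Variable a : A.

Lemma bicomm_self : star a = a -> bicomm a a.
Proof. by move=> aa; split. Qed.

Lemma bicommC x y : bicomm a x -> bicomm a y -> x ** y = y ** x.
Proof. by move=> [_ xa] [_ ya]; apply: xa; rewrite (ya a). Qed.

Lemma bicommD x y : bicomm a x -> bicomm a y -> bicomm a (x + y).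
Proof.
move=> [xx xa] [yy ya]; split=> [|z az]; first by rewrite starD xx yy.
by rewrite amulDl amulDr xa // ya.
Qed.

Lemma bicommZ (k : C) x : k^* = k -> bicomm a x -> bicomm a (k *: x).
Proof.
move=> kR [xx xa]; split=> [|z az]; first by rewrite starZ xx kR.
by rewrite amulZl amulZr xa.
Qed.

Lemma bicommN x : bicomm a x -> bicomm a (- x).
Proof. by rewrite -scaleN1r; apply: bicommZ; rewrite rmorphN rmorph1. Qed.

Lemma bicommB x y : bicomm a x -> bicomm a y -> bicomm a (x - y).
Proof. by move=> hx hy; apply: bicommD hx (bicommN hy). Qed.

Lemma bicommM x y : bicomm a x -> bicomm a y -> bicomm a (x ** y).
Proof.
move=> hx hy; have [xx xa] := hx; have [yy ya] := hy.
split=> [|z az]; first by rewrite starM xx yy (bicommC hy hx).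
by rewrite -amulA ya // amulA xa // amulA.
Qed.

Lemma bicomm0 : bicomm a 0.
Proof. by split=> [|z _]; rewrite ?star0 ?amul0l ?amul0r. Qed.

Lemma bicomm_cvg u x :
  u @ \oo --> x -> (forall k, bicomm a (u k)) -> bicomm a x.
Proof.
move=> ux ua; split=> [|z az].
  apply: (cvg_uniq _ ux); have := cvg_star ux.
  by under eq_fun do rewrite (proj1 (ua _)).
apply: (cvg_uniq (cvg_amul ux (cvg_cst z))).
under eq_fun do rewrite (proj2 (ua _) z az).
by apply: cvg_amul ux; apply: cvg_cst.
Qed.

Lemma bicomm_root_seq (b : bool) s k :
  bicomm a s -> bicomm a (root_seq (b%:R : C^o, s) k).2.
Proof.
move=> hs; elim: k => [|k IHk]; first exact: bicomm0.
rewrite root_seq2; apply: bicommZ halfJ _; apply: bicommD => //.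
have hl : (b%:R * majorant C k)^* = b%:R * majorant C k.
  by apply/CrealP; rewrite ger0_real ?mulr_ge0 ?ler0n ?majorant_ge0.
apply: bicommD (bicommM IHk IHk).
by apply: bicommD; apply: bicommZ.
Qed.

Lemma bicomm_root (b : bool) s : bicomm a s ->
  (forall y, `|uact (b%:R : C^o, s) y| <= `|y|) ->
  exists2 x, bicomm a x &
    x + x = s + (b%:R *: x + b%:R *: x + x ** x) /\
    forall y, `|uact (b%:R : C^o, x) y| <= `|y|.
Proof.
move=> sa s1; have [x [tx xE xc]] := root_seq_cvg s1.
by exists x => //; apply: (bicomm_cvg tx) => k; apply: bicomm_root_seq.
Qed.

End Bicommutant.

(* [a + k (1 - r)] is unitary when [k = i] or [k = - i]. *)
Lemma normr_cayley a r (k : C) y : star a = a -> star r = r ->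
  a ** r = r ** a -> k^* = - k -> k * k = -1 -> r + r = a ** a + r ** r ->
  `|a ** y + k *: (y - r ** y)| = `|y|.
Proof.
move=> aa rr ar kJ kk rE.
apply/eqP; rewrite -(@eqrXn2 _ 2) // -!normr_star_amul; apply/eqP; congr `|_|.
set w := y - r ** y.
rewrite starD starZ !starM aa kJ amulDl !amulDr !amulZl !amulZr scalerA.
rewrite mulNr kk opprK scale1r scaleNr.
have -> : star w ** (a ** y) = star y ** a ** w.
  rewrite /w starB starM rr amulBl amulBr -!amulA; congr (_ - _).
  by rewrite !amulA -[in RHS](amulA _ a) ar !amulA.
rewrite addrA addrK.
(* By [rE] this says [(1 - r) ^ 2 = 1 - a ^ 2], which cancels the term in [a ^ 2]. *)
have -> : star w ** w = star y ** y - star y ** (r + r - r ** r) ** y.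
  rewrite /w starB starM rr !(amulBl, amulBr, amulDl, amulDr) !amulA.
  by rewrite !(opprD, opprB) !addrA; congr (_ + _); rewrite addrAC.
by rewrite rE addrK !amulA addrC addrNK.
Qed.

(** Up to the factor ['i], [1 - r] is half the difference of two isometries, hence a contraction,
    and so is its square [1 - a ^ 2]. *)
Lemma contraction_sqr a y :
  star a = a -> `|a| <= 1 -> `|y - a ** a ** y| <= `|y|.
Proof.
move=> aa a1.
have aa1 z : `|uact (false%:R : C^o, a ** a) z| <= `|z|.
  rewrite /uact scale0r add0r (le_trans (normr_amul _ _)) //.
  by rewrite normr_selfadjoint_sqr // ler_piMl ?exprn_ile1.
have ha := bicomm_self aa.
have [r hr [rE _]] := bicomm_root (bicommM ha ha) aa1.
rewrite scale0r !add0r in rE.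
have rr := proj1 hr; have ar := bicommC ha hr.
have r1 z : `|z - r ** z| <= `|z|.
  have iJ : ('i : C)^* = - 'i by rewrite conjCi.
  have ii : ('i : C) * 'i = -1 by rewrite -expr2 sqrCi.
  have z1 := normr_cayley z aa rr ar iJ ii rE.
  have z2 : `|a ** z + (- 'i) *: (z - r ** z)| = `|z|.
    apply: normr_cayley => //; last by rewrite mulrNN.
    by rewrite [LHS]rmorphN [X in - X]iJ.
  rewrite -(ler_pM2l (@ltr0n C 2)) !mulr_natl [leRHS]mulr2n -{1}z1 -z2.
  apply: le_trans (ler_normB _ _).
  rewrite scaleNr opprD opprK addrACA subrr add0r -scalerDr -mulr2n normrZ.
  by rewrite normCi mul1r normrMn.
have -> : a ** a = r + r - r ** r by rewrite rE addrK.
have -> : y - (r + r - r ** r) ** y = (y - r ** y) - r ** (y - r ** y).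
  by rewrite amulBl amulDl amulBr amulA !opprD !opprK !addrA; congr (_ + _).
exact: le_trans (r1 _) (r1 _).
Qed.

Section Factor.
Variable a : A.
Hypotheses (aa : star a = a) (a1 : `|a| <= 1).

Lemma selfadjoint_factor : exists x y, a = x ** y.
Proof.
have ha := bicomm_self aa.
(* [x] is [- |a|], [w] is [- sqrt |a|] and [c k] tends to [a / sqrt |a|]. *)
have [x hx [xE x1]] : exists2 x, bicomm a x &
    x ** x = a ** a /\ forall y, `|uact (true%:R : C^o, x) y| <= `|y|.
  have [|x hx [xE xc]] := bicomm_root (b := true) (bicommN (bicommM ha ha)).
    by move=> y; rewrite /uact scale1r amulNl contraction_sqr.
  exists x => //; split=> //; move/esym/eqP: xE.
  rewrite !scale1r addrC -addrA -subr_eq0 addrAC subrr add0r subr_eq0.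
  by move/eqP.
have [w [tw wE _]] := root_seq_cvg x1.
set t := root_seq _ in tw.
have ht k : bicomm a (t k).2 by apply: bicomm_root_seq.
have hw := bicomm_cvg tw ht.
(* If [(t k).2 = q x] with [q] a polynomial in [x], then [c k = q a]. As [x ^ 2 = a ^ 2], products
   of the [c k] equal those of the [(t k).2], so the two sequences have the same mutual
   distances. *)
pose c := fix c k : A := if k is k'.+1 then
  2^-1 *: (a + (majorant C k' *: c k' + majorant C k' *: c k'
                + c k' ** (t k').2))
  else 0.
have tS k : (t k.+1).2 = 2^-1 *: (x + (majorant C k *: (t k).2
    + majorant C k *: (t k).2 + (t k).2 ** (t k).2)).
  by rewrite /t root_seq2 mul1r.
have hc k : bicomm a (c k).
  elim: k => [|k IHk] /=; first exact: bicomm0.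
  have IHm := bicommZ (majorantJ k) IHk.
  apply: bicommZ halfJ _; apply: bicommD => //.
  exact: bicommD (bicommD IHm IHm) (bicommM IHk (ht k)).
have ac k : a ** c k = x ** (t k).2.
  elim: k => [|k IHk]; first by rewrite !amul0r.
  by rewrite tS /= !(amulZr, amulDr) !amulA IHk xE.
have cc j k : c j ** c k = (t j).2 ** (t k).2.
  elim: j => [|j IHj]; first by rewrite !amul0l.
  rewrite tS /= !(amulZl, amulDl) IHj ac; congr (_ *: (_ + (_ + _))).
  by rewrite (bicommC (hc j)) // -amulA IHj amulA.
have cB j k : `|c k - c j| = `|(t k).2 - (t j).2|.
  apply/eqP; rewrite -(@eqrXn2 _ 2) // -!normr_star_amul.
  have [-> _] := bicommB (hc k) (hc j); have [-> _] := bicommB (ht k) (ht j).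
  by rewrite !(amulBl, amulBr) !cc.
have [d cd] : exists d : A, c @ \oo --> d.
  apply: (@majorant_cauchy _ _ c) => j k jk; rewrite cB.
  exact: root_seq_cauchy x1 _ _ jk.
have hd := bicomm_cvg cd hc.
have ad : a ** d = x ** w.
  apply: (cvg_uniq (cvg_amul (cvg_cst a) cd)).
  by under eq_fun do rewrite ac; apply: cvg_amul tw; apply: cvg_cst.
have ww : w ** w = - x.
  apply/eqP; rewrite -addr_eq0; apply/eqP.
  apply: (addrI (w + w)); rewrite addr0 [RHS]wE !scale1r.
  by rewrite addrA addrC.
exists (- d), w; apply/eqP; rewrite amulNl -addr_eq0; apply/eqP.
(* Morally [d ** w = - a]. That [g = 0] is shown by letting [g] annihilate [a], then [x] (as
   [x ^ 2 = a ^ 2]), then [w] (as [w ^ 2 = - x]), and finally itself. *)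
set g := a + d ** w.
have hg : bicomm a g by apply: bicommD => //; apply: bicommM.
have sq0 z : bicomm a z -> z ** z = 0 -> z = 0.
  by move=> [zz _] z0; apply: cstar_proper; rewrite zz.
have sqM z1 z2 : bicomm a z1 -> bicomm a z2 ->
    z1 ** z2 ** (z1 ** z2) = z1 ** z1 ** (z2 ** z2).
  move=> h1 h2; rewrite -!amulA; congr (_ ** _).
  by rewrite !amulA (bicommC h2).
have ga : g ** a = 0.
  rewrite (bicommC hg ha) amulDr amulA ad -amulA ww amulNr xE subrr //.
have gx : g ** x = 0.
  apply: sq0; first exact: bicommM.
  by rewrite sqM // xE -sqM // ga amul0l.
have gw : g ** w = 0.
  apply: sq0; first exact: bicommM.
  by rewrite sqM // ww amulNr -amulA gx amul0r oppr0.
by apply: sq0 => //; rewrite {2}/g amulDr ga add0r (bicommC hd hw) amulA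
  gw amul0l.
Qed.

End Factor.

Lemma selfadjoint_factor_scaled a : star a = a -> exists x y, a = x ** y.
Proof.
move=> aa; have [->|a0] := eqVneq a 0; first by exists 0, 0; rewrite amul0l.
have an : `|a| != 0 by rewrite normr_eq0.
have nJ : (`|a|^-1 : C)^* = `|a|^-1.
  by apply/CrealP; rewrite ger0_real ?invr_ge0.
have [||x [y xy]] := @selfadjoint_factor (`|a|^-1 *: a).
- by rewrite starZ aa nJ.
- by rewrite normrZ normfV normr_id mulVf.
exists (`|a| *: x), y.
by rewrite amulZl -xy scalerA divff // scale1r.
Qed.

Lemma cstar_idempotent : idempotent_algebra A.
Proof.
move=> a.
have iJ : ('i : C)^* = - 'i by rewrite conjCi.
have [|x1 [y1 xy1]] := @selfadjoint_factor_scaled (a + star a).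
  by rewrite starD starK addrC.
have [|x2 [y2 xy2]] := @selfadjoint_factor_scaled ('i *: (a - star a)).
  by rewrite starZ starB starK iJ scaleNr -scalerN opprB.
(* The real and imaginary parts of [a], with the scalars absorbed into the first factors. *)
exists [:: (2^-1 *: x1, y1); ((2^-1 * - 'i) *: x2, y2)].
rewrite big_cons big_seq1 /= !amulZl -xy1 -xy2 !scalerA -mulrA mulNr.
rewrite -expr2 sqrCi opprK mulr1 -scalerDr addrACA subrr addr0 -mulr2n.
rewrite -[a *+ 2]scaler_nat.
by rewrite scalerA mulVf ?scale1r ?pnatr_eq0.
Qed.

End CStarFactorization.

(** * The result for C*-algebras *)

Theorem theorem4p7 (R : realType) (n : nat) (A B : cstarAlgType R)
    (phi : {linear A -> B}) (hn : (2 <= n)%N)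
    (hphi : n_homomorphism n phi) (hinv : involutive_map phi) :
  (~~ odd n -> star_homomorphism phi) /\
  ((3 <= n)%N -> odd n ->
    exists psi1 psi2 : {linear A -> B},
      [/\ star_homomorphism psi1, star_homomorphism psi2,
          orthogonal_maps psi1 psi2
        & forall a : A, phi a = psi1 a - psi2 a]).
Proof.
(* Here [N = n - 1], so the parities are exchanged. *)
case: n hn hphi => // N N0 hphi.
have [hodd heven] := involutive_n_homomorphism (@cstar_idempotent R A)
  (@cstar_proper R B) N0 hphi hinv.
by split=> /= [|_ //]; rewrite negbK.
Qed.
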